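(* Let $E$ be a finite-dimensional Euclidean space, let $A=\{a^1,\dots,a^m\}\subset E$ be a nonempty finite set, let $b\in E$, and let $K(A)=\bigcup_{\lambda\ge 0}\lambda A_c$ be the finitely generated convex cone with generators $A$, where $A_c=\mathrm{co}\{A\}$ is the convex hull of $A$. For $\rho>0$ let $b^K$, $b^\rho$ and $b^{\mathrm{co}}$ be the orthogonal projections of $b$ onto $K(A)$, onto $\rho A_c$, and onto $\mathrm{co}\{\mathbf 0,\rho A_c\}$, respectively, and assume that $\|b^K-b\|>0$ and $\|b^{\mathrm{co}}-b\|>0$. If $\rho>0$ is such that $\|b^\rho\|^2>\langle b,b^\rho\rangle$, then $b^K=b^{\mathrm{co}}$.
   Context: $E$ is a finite-dimensional real inner product space with inner product $\langle x,y\rangle$ and norm $\|x\|=\sqrt{\langle x,x\rangle}$; $\mathbf 0$ is its zero vector. For $\rho\in\mathbb R$ and $X\subset E$, $\rho X=\{\rho x: x\in X\}$. $\mathrm{co}\{\mathbf 0,\rho A_c\}$ denotes the convex hull of $\{\mathbf 0\}\cup\rho A_c$. The orthogonal projection of $b$ onto a nonempty closed convex set $X\subset E$ is the unique point of $X$ minimizing $\|x-b\|$ over $x\in X$. Thus $\|b^K-b\|=\min_{x\in K(A)}\|x-b\|$, $\|b^\rho-b\|=\min_{x\in\rho A_c}\|x-b\|$, and $\|b^{\mathrm{co}}-b\|=\min_{x\in\mathrm{co}\{\mathbf 0,\rho A_c\}}\|x-b\|$. *)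

(* Defs.v *)
From HB Require Import structures.
From mathcomp Require Import all_boot all_order all_algebra.
From mathcomp Require Export sesquilinear vector.
From mathcomp Require Export boolp classical_sets functions cardinality reals convex.

Set Implicit Arguments.
Unset Strict Implicit.
Unset Printing Implicit Defensive.

Import Order.TTheory GRing.Theory Num.Theory.

Local Open Scope classical_set_scope.
Local Open Scope ring_scope.

Section Euclidean.
Variables (R : realType) (E : vectType R).

(* [{dot E for idfun}] is the type of positive definite symmetric bilinear
   forms on [E], i.e. of real inner products. *)
Variable ip : {dot E for (@idfun R)}.

Definition enorm (x : E) : R := Num.sqrt (ip x x).

(* Minimizers over a convex set are unique, so for convex [X] at most one [p]
   satisfies [is_projection b X p]. *)
Definition is_projection (b : E) (X : set E) (p : E) : Prop :=
  X p /\ forall x, X x -> enorm (p - b) <= enorm (x - b).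

End Euclidean.

Section ConvexSets.
Variables (R : realType) (E : vectType R).

Definition scale_set (r : R) (X : set E) : set E := [set r *: x | x in X].

Definition convex_hull (X : set E) : set E :=
  smallest (fun Y : set E => convex_set Y) X.

Definition cone (A : set E) : set E :=
  \bigcup_(l in [set l : R | 0 <= l]) scale_set l (convex_hull A).

End ConvexSets.

(* Main.v *)
Require Import Defs.
From mathcomp Require Import all_boot all_order all_algebra.
From mathcomp Require Import boolp classical_sets functions cardinality reals convex.
From mathcomp Require Import interval_inference lra ring.

Import Order.TTheory GRing.Theory Num.Theory.

Local Open Scope classical_set_scope.
Local Open Scope ring_scope.

(* With p = brho and f x = |x - b|^2, the hypothesis says that f strictly
   decreases at p in the direction -p.  Write bK = t y with t >= 0 and y in
   rho A_c.  As p minimizes f on the convex set rho A_c, <y, b - p> <= <p, b - p>,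
   hence <bK - p, b - p> <= (t - 1) <p, b - p>, where <p, b - p> < 0; on the other
   hand f bK <= f p forces <bK - p, b - p> >= 0.  So t <= 1, i.e. bK lies in
   co {0, rho A_c}, and it minimizes f there because it does so on the larger
   cone K(A). *)

Section Convexity.
Context {R : realType} {E : vectType R}.
Implicit Types (X Y A : set E) (x y : E).

(** Trades the bundled interval coefficients of [convex_set] for a plain real [t] with bounds, which
    the arithmetic below needs. *)
Lemma convex_setP Y : convex_set Y <->
  forall t x y, 0 <= t <= 1 -> Y x -> Y y -> Y (t *: x + (1 - t) *: y).
Proof.
split=> [cY t x y /andP[t0 t1] Yx Yy|cY x y t].
  by have := cY x y (Itv01 t0 t1); rewrite !in_setE; apply.
by rewrite !in_setE; apply: cY; rewrite ge0 le1.
Qed.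

Lemma convex_hull_convex X : convex_set (convex_hull X).
Proof.
apply/convex_setP => t x y t01 Xx Xy Y [cY XY].
by move/convex_setP: (cY); apply=> //; [apply: Xx|apply: Xy].
Qed.

Lemma sub_convex_hull X : X `<=` convex_hull X.
Proof. exact: sub_gen_smallest. Qed.

Lemma convex_hull_sub {X Y} : convex_set Y -> X `<=` Y -> convex_hull X `<=` Y.
Proof. exact: smallest_sub. Qed.

Lemma scale_set_convex r X : convex_set X -> convex_set (scale_set r X).
Proof.
move=> /convex_setP cX; apply/convex_setP => t _ _ t01 [x Xx <-] [y Xy <-].
exists (t *: x + (1 - t) *: y); first exact: cX.
by rewrite scalerDr !scalerA mulrC [r * _]mulrC.
Qed.

(** With N = t l + (1 - t) m nonzero, t l x + (1 - t) m y is N times the convex combination of x and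
    y with weights t l / N and (1 - t) m / N. *)
Lemma cone_convex A : convex_set (cone A).
Proof.
apply/convex_setP => t _ _ /andP[t0 t1] [l /= l0 [x Ax <-]] [m /= m0 [y Ay <-]].
have [tl0 tm0] : 0 <= t * l /\ 0 <= (1 - t) * m.
  by rewrite !mulr_ge0// subr_ge0.
have N0 := addr_ge0 tl0 tm0; set N := _ + _ in N0.
rewrite !scalerA; exists N => //.
(* If [N] vanishes, so do both nonnegative summands; the combination is then 0, and any point of the
   hull serves as witness. *)
have [N0'|NN0] := eqVneq N 0.
  exists x => //; move/eqP: N0'; rewrite paddr_eq0// => /andP[/eqP tl /eqP tm].
  by rewrite /N tl tm !addr0 !scale0r addr0.
exists ((t * l / N) *: x + (1 - t * l / N) *: y).
  move/convex_setP: (@convex_hull_convex A); apply=> //.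
  by rewrite divr_ge0// ler_pdivrMr ?mul1r ?lerDl// lt_neqAle eq_sym NN0.
rewrite scalerDr !scalerA; congr (_ *: _ + _ *: _); first by field.
by rewrite mulrBr mulr1 mulrCA divff// mulr1 /N addrC addKr.
Qed.

End Convexity.

Section Projection.
Context {R : realType} {E : vectType R} {ip : {dot E for (@idfun R)}}.
Implicit Types (X Y : set E) (x y b p q : E).

Lemma ip_sym x y : ip x y = ip y x.
Proof. by rewrite (hermC ip) /= expr0 mul1r. Qed.

Lemma ip_ge0 x : 0 <= ip x x.
Proof.
have [->|/(@neq0_dnorm_gt0 _ _ _ ip)/ltW//] := eqVneq x 0.
by rewrite linear0r.
Qed.

Lemma enorm_sqr x : enorm ip x ^+ 2 = ip x x.
Proof. by rewrite sqr_sqrtr ?ip_ge0. Qed.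

Lemma ler_enorm x y : (enorm ip x <= enorm ip y) = (ip x x <= ip y y).
Proof. by rewrite ler_sqrt ?ip_ge0. Qed.

Lemma is_projection_sub {b X Y p} : X `<=` Y -> X p ->
  is_projection ip b Y p -> is_projection ip b X p.
Proof. by move=> XY Xp [_ pP]; split=> // x /XY /pP. Qed.

Lemma dot_distance b p x (c := ip (x - p) (b - p)) :
  ip (x - b) (x - b) = ip (p - b) (p - b) - 2 * c + ip (x - p) (x - p).
Proof.
have -> : x - b = (x - p) - (b - p) by rewrite opprB addrA subrK.
rewrite -(opprB b p) (hnormN ip) (hnormB ip) /= expr0 mul1r /c; ring.
Qed.

(** Moving from p to p + t (x - p) changes the squared distance to b by t^2 d - 2 t c, with d = |x -
    p|^2; if c > 0, this is negative for small t > 0. *)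
Lemma projection_variational {b X p x} : convex_set X ->
  is_projection ip b X p -> X x -> ip (x - p) (b - p) <= 0.
Proof.
move=> /convex_setP cX [Xp pmin] Xx; rewrite leNgt; apply/negP => c_gt0.
set c := ip _ _ in c_gt0; have d_ge0 := ip_ge0 (x - p); set d := ip _ _ in d_ge0.
have dc_gt0 : 0 < d + c by lra.
(* This choice keeps [t] in (0, 1] and gives t d = c - t c < 2 c, so the squared distance strictly
   drops. *)
pose t := c / (d + c).
have t_gt0 : 0 < t by rewrite divr_gt0.
have t01 : 0 <= t <= 1 by rewrite ltW//= ler_pdivrMr// mul1r lerDr.
have := pmin _ (cX t x p t01 Xx Xp); rewrite ler_enorm (dot_distance b p (_ + _)).
have -> : t *: x + (1 - t) *: p - p = t *: (x - p).
  by rewrite scalerBl scale1r scalerBr addrA addrAC addrK.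
rewrite linearZl_LR linearZl_LR linearZr_LR /= -/c -/d.
have tE : t * (d + c) = c by rewrite divfK// gt_eqF.
have : 0 < t * c by rewrite mulr_gt0.
have : 0 <= t * d by exact: mulr_ge0 (ltW t_gt0) d_ge0.
have : t * (t * d) = t * c - t * (t * c) by rewrite -mulrBr; congr (_ * _); lra.
have : 0 < t * (t * c) by exact: mulr_gt0 t_gt0 (mulr_gt0 t_gt0 c_gt0).
lra.
Qed.

(** The variational inequalities at p and at q add up to |p - q|^2 <= 0. *)
Lemma projection_unique {b X p q} : convex_set X ->
  is_projection ip b X p -> is_projection ip b X q -> p = q.
Proof.
move=> cX pP qP; apply/eqP; rewrite -subr_eq0; apply/negPn/negP.
move=> /(@neq0_dnorm_gt0 _ _ _ ip); apply/negP; rewrite -leNgt.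
have := projection_variational cX pP qP.1.
have := projection_variational cX qP pP.1.
have -> : ip (p - q) (p - q) = ip (p - q) (b - q) + ip (q - p) (b - p).
  rewrite -[in X in _ = _ + X](opprB p q) linearNl -linearBr.
  by congr (ip _ _); rewrite [RHS]addrC opprB addrA subrK.
lra.
Qed.

End Projection.

Theorem theorem2p1 (R : realType) (E : vectType R)
    (ip : {dot E for (@idfun R)})
    (A : set E) (b : E) (rho : R) (bK brho bco : E) :
  finite_set A -> A !=set0 ->
  0 < rho ->
  is_projection ip b (cone A) bK ->
  is_projection ip b (scale_set rho (convex_hull A)) brho ->
  is_projection ip b
    (convex_hull ([set 0] `|` scale_set rho (convex_hull A))) bco ->
  0 < enorm ip (bK - b) ->
  0 < enorm ip (bco - b) ->
  ip b brho < enorm ip brho ^+ 2 ->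
  bK = bco.
Proof.
move=> _ [a0 Aa0] rho_gt0 bKP brhoP bcoP _ _; rewrite enorm_sqr => brho_gt.
set H := convex_hull A in brhoP bcoP *.
have cH : convex_set H by exact: convex_hull_convex.
have cco := convex_hull_convex ([set 0] `|` scale_set rho H).
have co_cone : convex_hull ([set 0] `|` scale_set rho H) `<=` cone A.
  apply: (convex_hull_sub (cone_convex A)) => x [->|rHx].
    exists 0 => //=; exists a0; first exact: sub_convex_hull.
    by rewrite scale0r.
  by exists rho => //=; exact: ltW.
suff co_bK : convex_hull ([set 0] `|` scale_set rho H) bK.
  exact: (projection_unique cco (is_projection_sub co_cone co_bK bKP) bcoP).
have [[l /= l_ge0 [a Ha alE]] bKmin] := bKP.
have rHa : scale_set rho H (rho *: a) by exists a.
pose t := l / rho.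
have t_ge0 : 0 <= t by rewrite divr_ge0// ltW.
have bKE : bK = t *: (rho *: a) by rewrite scalerA divfK ?gt_eqF.
have t_le1 : t <= 1.
  rewrite leNgt; apply/negP => t_gt1.
  have cone_brho : cone A brho by exists rho; [exact: ltW|exact: brhoP.1].
  set u := ip brho (b - brho); set v := ip (rho *: a) (b - brho).
  (* This is the hypothesis on [brho], as u = <b, brho> - |brho|^2. *)
  have u_lt0 : u < 0 by rewrite /u linearBr /= subr_lt0 ip_sym.
  have vu_le0 : v - u <= 0.
    rewrite -linearBl.
    exact: projection_variational (scale_set_convex rho _ cH) brhoP rHa.
  have tvu_le0 : t * (v - u) <= 0 by exact: mulr_ge0_le0.
  have tu_lt0 : (t - 1) * u < 0 by rewrite pmulr_rlt0// subr_gt0.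
  (* Minimality of [bK] gives 2 (t v - u) >= |bK - brho|^2 >= 0, whereas t v - u = t (v - u) + (t -
     1) u < 0. *)
  have := bKmin _ cone_brho; rewrite ler_enorm (dot_distance b brho bK).
  have -> : ip (bK - brho) (b - brho) = t * v - u.
    by rewrite linearBl bKE linearZl_LR.
  have := @ip_ge0 _ _ ip (bK - brho).
  rewrite mulrBl mul1r in tu_lt0; rewrite mulrBr in tvu_le0; lra.
(* [bK] is the convex combination of [rho *: a] and 0 with weights [t] and [1 - t]. *)
have := (convex_setP _).1 cco t (rho *: a) 0; rewrite scaler0 addr0 -bKE t_ge0 t_le1.
by apply=> //; apply: sub_convex_hull; [right|left].
Qed.
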